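(* Consider an error mitigation (EM) protocol with negligible bias and a family of instances $(C,O)$ of the expectation value estimation problem with accuracy parameter $\epsilon=\epsilon(n)<1$, where $C$ is a circuit of depth $D$ with active volume $V$ and $n$ active qubits, the two-qubit gate infidelity is $\gamma$, and $M$ is the number of shots the protocol uses to achieve statistical error at most $\epsilon$. Let $\overline{\gamma}\in(0,1]$ be a constant independent of $n$. Assume that one of the following two conditions holds. (i) For all instances in the family, $M\ge \frac{1}{\epsilon^2}e^{\lambda\gamma V}$, where $\lambda\gamma\ge\overline{\gamma}$. (ii) The depths of the circuits satisfy $D\ge n$, and the conditions for the exponential lower bound in $D$ hold, namely: the circuit is affected by a local depolarizing error model, the observable $O$ is traceless, and its ideal expectation value satisfies $|\langle O\rangle_{C}|>2\epsilon$; so that $M\ge\frac{1}{\epsilon^2}e^{\lambda\gamma D}$, where $\lambda\gamma\ge\overline{\gamma}$. Let $T_c$ be the time required to solve the expectation value estimation problem to accuracy $\epsilon$ classically using the best available algorithm, and let $T_{EM}$ be the time required to solve it on a quantum processor using the EM protocol. Then, in either case, the classical run time is polynomially bounded by the EM run time: $$T_c=O\big(T_{EM}^{1/\overline{\gamma}}\big)\qquad (n\to\infty).$$ Consequently any asymptotic quantum advantage of EM over classical computation on this family is at most polynomial (with degree $1/\overline{\gamma}$), and in particular there is no exponential asymptotic quantum advantage of EM over classical computation.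
   Context: **Expectation value estimation.** An instance is a pair $(C,O)$, with $C$ a quantum circuit on $n$ qubits (of size bounded by a fixed polynomial in $n$) and $O$ a tensor product observable with operator norm $\|O\|_{op}=1$. The task is to output an estimate of $\langle O\rangle_C:=\langle 0^n|C^\dagger O C|0^n\rangle$ with root-mean-square error (over the randomness of the algorithm) at most $\epsilon=\epsilon(n)<1$. The number $\langle O\rangle_C$ is the ideal (noise-free) expectation value. **Depth.** $D\ge 1$ is the number of layers of $C$; each layer contains at most $n/2$ two-qubit gates. **Active volume and active qubits.** The active volume $V$ of $(C,O)$ is the size of the smallest subset $S$ of the two-qubit gates of $C$ such that arbitrary modifications of the gates outside $S$ (replacing each $k$-qubit gate by an arbitrary $k$-qubit unitary) change $\langle O\rangle_C$ by an amount negligible relative to $\epsilon$. In particular $V\le nD/2$. The active qubits are those acted on by some gate in the active volume; it is assumed throughout that all $n$ qubits are active, and in particular $n\le V$. **Noise and error mitigation.** $\gamma$ is the (average) infidelity of the noisy two-qubit gates. An EM protocol is a protocol without adaptive quantum operations that replaces the execution of $C$ by $M$ noisy circuit executions (''shots''), whose results are classically post-processed to give an estimate of $\langle O\rangle_C$. Only protocols whose bias (the estimation error remaining with infinitely many shots) is negligible relative to $\epsilon$ are considered. The parameter $\lambda>0$ is called the blow-up rate. A local depolarizing error model is one in which a depolarizing channel acts on each qubit after each layer. The lower bound $M\ge\epsilon^{-2}e^{\lambda\gamma D}$ under the conditions listed in (ii) is a known result from the literature and is taken as given. **Cost conventions.** The EM run time is at least proportional to the total circuit depth over all shots, $T_{EM}=\Omega(DM)$.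 The classical run time is counted in floating-point operations; since $T_c$ refers to the best available algorithm, it is at most the cost of state-vector simulation of the ideal $n$-qubit circuit with $V$ two-qubit gates, i.e. $T_c=O(V2^n)$. **Asymptotic quantum advantage.** Let $S_Q(n)$, $S_C(n)$ be the quantum and classical costs (here $T_{EM}$ and $T_c$). Asymptotic quantum advantage holds if $\lim_{n\to\infty}S_Q(n)/S_C(n)=0$. It is (at most) polynomial if in addition $S_C(n)\le\mathrm{poly}(S_Q(n),n)$, and (at least) exponential if in addition $S_Q(n)\le \mathrm{poly}(\log S_C(n),n)$. *)

(* Defs.v *)
From HB Require Import structures.
From mathcomp Require Export all_boot all_order all_algebra.
From mathcomp Require Export spectral complex polyXY.
From mathcomp Require Export all_classical all_reals all_analysis.
Export Order.TTheory GRing.Theory Num.Theory.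
Export numFieldNormedType.Exports.

Set Implicit Arguments.
Unset Strict Implicit.
Unset Printing Implicit Defensive.

Global Open Scope classical_set_scope.
Global Open Scope ring_scope.

(* Computational basis states of n qubits, and operators on n qubits, i.e.
   square matrices whose rows and columns are indexed by the basis states. *)
Notation bits n := {ffun 'I_n -> bool}.
Notation operator R n := 'M[R[i]]_(#|{: bits n}|).
Notation "A ^dag" := (map_mx Num.conj A)^T (at level 8, format "A ^dag").

Section Qubits.
Context {R : realType}.
Implicit Types n : nat.

Definition op_of n (f : bits n -> bits n -> R[i]) : operator R n :=
  \matrix_(a, b) f (enum_val a) (enum_val b).

Definition entry n (A : operator R n) (x y : bits n) : R[i] :=
  A (enum_rank x) (enum_rank y).

Definition ket n (x : bits n) : 'cV[R[i]]_(#|{: bits n}|) :=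
  \col_a (enum_val a == x)%:R.

Definition zero_bits n : bits n := [ffun => false].

Definition vnorm N (v : 'cV[R[i]]_N) : R := Num.sqrt (complex.Re ((v^dag *m v) 0 0)).

Definition opnorm N (A : 'M[R[i]]_N) : R :=
  sup [set vnorm (A *m v) | v in [set v : 'cV[R[i]]_N | vnorm v = 1]].

(* [mask A x] is the restriction of x to the qubits in A, padded with zeros,
   so u below is an operator on the qubits in A, and U = u (x) Id. *)
Definition mask n (A : {set 'I_n}) (x : bits n) : bits n :=
  [ffun i => (i \in A) && x i].

Definition acts_on n (A : {set 'I_n}) (U : operator R n) : Prop :=
  exists u : bits n -> bits n -> R[i],
    U = op_of (fun x y =>
      if [forall i, (i \notin A) ==> (x i == y i)]
      then u (mask A x) (mask A y) else 0).

Definition tensor_product_observable n (O : operator R n) : Prop :=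
  exists o : 'I_n -> 'M[R[i]]_2,
    (forall i, (o i)^dag = o i) /\
    O = op_of (fun x y => \prod_i o i (inord (x i)) (inord (y i))).

End Qubits.

(* A circuit of depth d on n qubits.  A gate location (l, A) means that in
   layer l a gate is applied to the set of qubits A; gates are one-qubit or
   two-qubit gates, and those of one layer act on disjoint qubits. *)
Notation location n d := ('I_d * {set 'I_n})%type.

Record circuit (R : realType) (n d : nat) := Circuit {
  gates : {set location n d} ;
  gate_op : location n d -> operator R n ;
  gate_arity : forall g, g \in gates -> (0 < #|g.2| <= 2)%N ;
  gate_disjoint : forall g h, g \in gates -> h \in gates ->
    g.1 = h.1 -> g != h -> [disjoint g.2 & h.2]%B ;
  gate_unitary : forall g, g \in gates -> gate_op g \is unitarymx ;
  gate_local : forall g, g \in gates -> acts_on g.2 (gate_op g) }.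

Section Circuits.
Context {R : realType} {n d : nat}.
Implicit Type C : circuit R n d.

Definition two_qubit_gates C : {set location n d} :=
  [set g in gates C | #|g.2| == 2].

Definition layer_op C (l : 'I_d) : operator R n :=
  \big[mulmx/1%:M]_(A | (l, A) \in gates C) gate_op C (l, A).

Definition final_state C : 'cV[R[i]]_(#|{: bits n}|) :=
  foldl (fun v l => layer_op C l *m v) (ket (zero_bits n)) (enum 'I_d).

Definition expectation C (O : operator R n) : R :=
  complex.Re (((final_state C)^dag *m O *m final_state C) 0 0).

End Circuits.

Record instance (R : realType) (n : nat) := Instance {
  depth : nat ;
  circ : circuit R n depth ;
  obs : operator R n }.

Section Instances.
Context {R : realType} {n : nat}.
Implicit Type x : instance R n.

Definition valid_instance x : Prop :=
  (0 < depth x)%N /\ tensor_product_observable (obs x) /\ opnorm (obs x) = 1.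

Definition ideal x : R := expectation (circ x) (obs x).

(* C' arises from the circuit of x by replacing the two-qubit gates outside S
   with arbitrary two-qubit unitaries on the same qubits.  One-qubit gates are
   regarded as fixed: they are never counted in the volume. *)
Definition modification x (S : {set location n (depth x)})
    (C' : circuit R n (depth x)) : Prop :=
  gates C' = gates (circ x) /\
  forall g, g \in gates (circ x) -> g \in S \/ #|g.2| = 1 ->
    gate_op C' g = gate_op (circ x) g.

Definition insensitive_outside (tol : R) x (S : {set location n (depth x)}) :=
  forall C', modification S C' -> `|expectation C' (obs x) - ideal x| <= tol.

(* Smallest sets of two-qubit gates outside of which modifications change the
   expectation value by at most tol. *)
Definition active_set (tol : R) x (S : {set location n (depth x)}) : Prop :=
  [/\ S \subset two_qubit_gates (circ x), insensitive_outside tol S &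
      forall S' : {set location n (depth x)},
        S' \subset two_qubit_gates (circ x) -> insensitive_outside tol S' ->
        (#|S| <= #|S'|)%N].

(* The size of any active set; the set of all two-qubit gates always qualifies
   as a candidate (for tol >= 0). *)
Definition active_volume (tol : R) x : nat :=
  #|[arg min_(S < two_qubit_gates (circ x) |
        (S \subset two_qubit_gates (circ x)) && `[< insensitive_outside tol S >])
      #|S| ]|.

Definition active_qubits x (S : {set location n (depth x)}) : {set 'I_n} :=
  [set q | [exists g in S, q \in g.2]].

Definition all_qubits_active (tol : R) x : Prop :=
  exists2 S, active_set tol S & active_qubits (x := x) S = [set: 'I_n]%SET.

End Instances.

Section Noise.
Context {R : realType} {n : nat}.

(* Channels in Kraus form. *)
Definition channel (Phi : operator R n -> operator R n) : Prop :=
  exists (r : nat) (K : 'I_r -> operator R n),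
    \sum_k (K k)^dag *m K k = 1%:M /\
    forall rho, Phi rho = \sum_k K k *m rho *m (K k)^dag.

Definition set_bit (x : bits n) (q : 'I_n) (b : bool) : bits n :=
  [ffun i => if i == q then b else x i].

(* rho |-> (1 - p) rho + p (Tr_q rho (x) Id_q / 2) *)
Definition depolarizing (q : 'I_n) (p : R) (rho : operator R n) : operator R n :=
  (1 - p)%:C%C *: rho +
  p%:C%C *: op_of (fun x y =>
    if x q == y q
    then 2^-1 * \sum_(b : bool) entry rho (set_bit x q b) (set_bit y q b)
    else 0).

Definition local_depolarizing_channel (Phi : operator R n -> operator R n) : Prop :=
  exists p : 'I_n -> R, (forall q, 0 < p q <= 1) /\
    forall rho, Phi rho = foldl (fun s q => depolarizing q (p q) s) rho (enum 'I_n).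

Definition glue (A : {set 'I_n}) (x y : bits n) : bits n :=
  [ffun i => if i \in A then x i else y i].

(* Entanglement fidelity of the marginal channel on the qubits in A,
   E(s) = Tr_(A^c) Phi(s (x) Id / 2^(n - |A|)), that is
     4^-|A| \sum_(a, b in {0,1}^A) <a| E(|a><b|) |b>.
   Below x = (a, c), y = (b, c), z = (a, c') and glue A y z = (b, c'). *)
Definition entanglement_fidelity (A : {set 'I_n})
    (Phi : operator R n -> operator R n) : R :=
  complex.Re (\sum_(x : bits n)
    \sum_(y : bits n | [forall i, (i \notin A) ==> (y i == x i)])
    \sum_(z : bits n | [forall i, (i \in A) ==> (z i == x i)])
      entry (Phi (ket x *m (ket y)^dag)) z (glue A y z))
  / 2 ^+ (n + #|A|).

End Noise.

(* A noisy device: when it runs a circuit, the ideal layer l is followed by the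
   channel [layer_noise C l]. *)
Record noise_model (R : realType) := NoiseModel {
  layer_noise : forall n d : nat,
    circuit R n d -> 'I_d -> operator R n -> operator R n ;
  layer_noise_channel : forall n d (C : circuit R n d) l, channel (layer_noise C l) }.

Section NoisyExecution.
Context {R : realType} (N : noise_model R) {n d : nat}.
Implicit Type C : circuit R n d.

Definition noisy_state C : operator R n :=
  foldl (fun rho l => layer_noise N C l (layer_op C l *m rho *m (layer_op C l)^dag))
    (ket (zero_bits n) *m (ket (zero_bits n))^dag) (enum 'I_d).

Definition outcome_prob C (y : bits n) : R := complex.Re (entry (noisy_state C) y y).

Definition locally_depolarized C : Prop :=
  forall l, local_depolarizing_channel (layer_noise N C l).

(* Infidelity of the noisy two-qubit gates, averaged over these gates.  The
   infidelity of a gate is 1 - (entanglement fidelity with the ideal gate). *)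
Definition avg_infidelity C : R :=
  (\sum_(g in two_qubit_gates C)
     (1 - entanglement_fidelity g.2 (layer_noise N C g.1)))
  / #|two_qubit_gates C|%:R.

End NoisyExecution.

(* A real-valued estimate that depends on finitely many random bits. *)
Record estimate (R : realType) := Estimate {
  outcome : finType ;
  prob : outcome -> R ;
  value : outcome -> R }.

Section Estimates.
Context {R : realType}.
Implicit Types (e : estimate R) (t : R).

Definition is_distribution (T : finType) (p : T -> R) : Prop :=
  (forall o, 0 <= p o) /\ \sum_o p o = 1.

Definition mean e : R := \sum_o prob o * value (e := e) o.

Definition rms_error e t : R :=
  Num.sqrt (\sum_o prob o * (value (e := e) o - t) ^+ 2).

Definition statistical_error e : R := rms_error e (mean e).

End Estimates.

(* The m circuits of an m-shot run may depend on a classical random seed drawn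
   beforehand, but not on measurement outcomes (no adaptive operations).  They
   may act on a number [em_width] of qubits different from n.  Each shot is
   measured in the computational basis. *)
Record em_protocol (R : realType) := EMProtocol {
  em_width : forall n, instance R n -> nat ;
  em_seed : forall n, instance R n -> nat -> finType ;
  em_seed_prob : forall n (x : instance R n) m, em_seed x m -> R ;
  em_seed_distribution : forall n (x : instance R n) m,
    is_distribution (em_seed_prob (x := x) (m := m)) ;
  em_depth : forall n (x : instance R n) m, em_seed x m -> 'I_m -> nat ;
  em_circuit : forall n (x : instance R n) m (s : em_seed x m) (j : 'I_m),
    circuit R (em_width x) (em_depth s j) ;
  em_postprocess : forall n (x : instance R n) m,
    em_seed x m -> {ffun 'I_m -> bits (em_width x)} -> R ;
  (* number of shots M used, and run time *)
  em_shots : forall n, instance R n -> nat ;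
  em_time : forall n, instance R n -> R }.

Section ErrorMitigation.
Context {R : realType} (N : noise_model R) (P : em_protocol R).

Definition em_estimate n (x : instance R n) (m : nat) : estimate R :=
  @Estimate R (em_seed P x m * {ffun 'I_m -> bits (em_width P x)})%type
    (fun o => em_seed_prob o.1 * \prod_j outcome_prob N (em_circuit o.1 j) (o.2 j))
    (fun o => em_postprocess o.1 o.2).

Definition bias_at_most (tol : R) n (x : instance R n) : Prop :=
  exists2 b : R, mean (em_estimate x m) @[m --> \oo] --> b & `|b - ideal x| <= tol.

(* Conditions for the lower bound exponential in the depth. *)
Definition depth_bound_conditions (eps : R) n (x : instance R n) : Prop :=
  [/\ locally_depolarized N (circ x),
      (forall m (s : em_seed P x m) j, locally_depolarized N (em_circuit s j)),
      \tr (obs x) = 0 &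
      `|ideal x| > 2 * eps].

End ErrorMitigation.

Record classical_algorithm (R : realType) := ClassicalAlgorithm {
  output : forall n, instance R n -> estimate R ;
  flops : forall n, instance R n -> nat }.

Section Costs.
Context {R : realType}.

Notation family := (forall n, set (instance R n)).
Implicit Types (F : family) (eps : nat -> R).

Definition sizes F : set nat := [set n | F n !=set0].

(* n tends to infinity through the sizes that occur in the family. *)
Definition n_to_oo F : set_system nat := within (sizes F) \oo.

Lemma n_to_oo_filter F : Filter (n_to_oo F).
Proof. exact: within_filter. Qed.

Canonical n_to_oo_filter_on F := FilterType (n_to_oo F) (n_to_oo_filter F).

Definition polynomial_size F : Prop :=
  exists p : {poly R}, forall n (x : instance R n), F n x ->
    #|gates (circ x)|%:R <= p.[n%:R].

Definition worst_case (cost : forall n, instance R n -> R) F (n : nat) : R :=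
  sup [set cost n x | x in F n].

Definition finite_worst_case (cost : forall n, instance R n -> R) F : Prop :=
  forall n, has_ubound [set cost n x | x in F n].

Definition flops_real (A : classical_algorithm R) n (x : instance R n) : R :=
  (flops A x)%:R.

Definition solves eps F (A : classical_algorithm R) : Prop :=
  (forall n (x : instance R n), F n x ->
     is_distribution (prob (e := output A x)) /\
     rms_error (output A x) (ideal x) <= eps n) /\
  finite_worst_case (flops_real A) F.

Definition best_available (avail : classical_algorithm R -> Prop) eps F
    (A : classical_algorithm R) : Prop :=
  [/\ avail A, solves eps F A &
      forall B, avail B -> solves eps F B ->
        worst_case (flops_real A) F =O_ (n_to_oo F) worst_case (flops_real B) F].

(* Number of operations O(V 2^n), as for state-vector simulation of an ideal
   n-qubit circuit of active volume V. *)
Definition state_vector_cost (tol : nat -> R) F (A : classical_algorithm R) : Prop :=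
  exists K : R, forall n (x : instance R n), F n x ->
    flops_real A x <= K * (active_volume (tol n) x)%:R * 2 ^+ n.

End Costs.

Section Advantage.
Context {R : realType} (F : set_system nat) (SQ SC : nat -> R).

Definition asymptotic_advantage : Prop := SQ n / SC n @[n --> F] --> (0 : R).

Definition polynomial_advantage : Prop :=
  asymptotic_advantage /\
  exists p : {poly {poly R}}, \forall n \near F, SC n <= p.[SQ n, n%:R].

Definition exponential_advantage : Prop :=
  asymptotic_advantage /\
  exists p : {poly {poly R}}, \forall n \near F, SQ n <= p.[ln (SC n), n%:R].

End Advantage.

(* Main.v *)
(* In both cases T_EM >= c D e^(gbar n), because V >= n, respectively D >= n.
   A layer has at most n gates, so V <= D n, and state-vector simulation costs
   O(V 2^n) = O(D n 2^n) = O(D e^n), which is O((D e^(gbar n))^(1/gbar)) as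
   D >= 1 and 1/gbar >= 1.  An exponential advantage would then bound T_EM by a
   polynomial in log T_EM, although T_EM grows at least like e^(gbar n). *)
Require Import Defs.
From mathcomp Require Import ring lra.

Set Implicit Arguments.
Unset Strict Implicit.
Unset Printing Implicit Defensive.

(** * Gate counts and the active volume *)

(** Sending a gate to its layer and one of its qubits is injective, because the gates of one layer
    are disjoint. *)
Lemma card_gates_le (R : realType) (n d : nat) (C : circuit R n d) :
  (#|gates C| <= d * n)%N.
Proof.
case: n C => [|n] C.
  rewrite muln0 leqn0 ; apply/eqP/eq_card0 => g.
  apply/negP => gC; have /andP[/card_gt0P[q _] _] := gate_arity gC.
  by case: q.
pose f (g : location n.+1 d) := (g.1, odflt ord0 [pick q in g.2]).
have f_in g : g \in gates C -> (f g).2 \in g.2.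
  move=> gC; have /andP[/card_gt0P[q qg] _] := gate_arity gC.
  by rewrite /f /=; case: pickP => [//|/(_ q)]; rewrite qg.
have f_inj : {in gates C &, injective f}.
  move=> g h gC hC fgh; apply/eqP/negPn/negP => gh.
  have gh1 : g.1 = h.1 by case: fgh.
  have /disjointFr := gate_disjoint gC hC gh1 gh.
  by move=> /(_ _ (f_in g gC)); rewrite fgh f_in.
by rewrite -(card_in_imset f_inj) (leq_trans (max_card _))// card_prod !card_ord.
Qed.

Lemma active_volume_le (R : realType) (n : nat) (tol : R) (x : instance R n) :
  (active_volume tol x <= depth x * n)%N.
Proof.
apply: leq_trans (card_gates_le (circ x)).
have two : two_qubit_gates (circ x) \subset gates (circ x).
  by apply/fintype.subsetP => g; rewrite inE => /andP[].
(* If the [pick] fails, the default is the set of all two-qubit gates, again a subset of [gates]. *)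
rewrite /active_volume /arg_min /extremum; apply: subset_leq_card.
by case: pickP => [S /andP[/andP[/fintype.subset_trans-> //]]|].
Qed.

(** * Growth of polynomials, exponentials and logarithms *)

Lemma norm_horner_le (R : realType) (p : {poly R}) :
  exists A k, 0 <= A /\ forall x L, 1 <= L -> `|x| <= L -> `|p.[x]| <= A * L ^+ k.
Proof.
elim/poly_ind: p => [|p c [A [k [A0 Ak]]]].
  by exists 0, 0%N; split => // x L _ _; rewrite horner0 normr0 mul0r.
exists (A + `|c|), k.+1; split => [|x L L1 xL]; first exact: addr_ge0.
rewrite hornerMXaddC (le_trans (ler_normD _ _))// normrM mulrDl lerD//.
  by rewrite exprSr mulrA ler_pM// Ak.
by rewrite ler_peMr// exprn_ege1.
Qed.

(** A common bound [L] on both arguments gives growth by a single power of [L]; [1 <= L] absorbs the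
    lower powers. *)
Lemma norm_horner2_le (R : realType) (p : {poly {poly R}}) :
  exists A k, 0 <= A /\ forall x y L, 1 <= L -> `|x| <= L -> `|y| <= L ->
    `|p.[x, y]| <= A * L ^+ k.
Proof.
elim/poly_ind: p => [|p c [A [k [A0 Ak]]]].
  by exists 0, 0%N; split => // x y L _ _ _; rewrite !horner0 normr0 mul0r.
have [A' [k' [A'0 Ak']]] := norm_horner_le c.
exists (A + A'), (k.+1 + k')%N; split => [|x y L L1 xL yL]; first exact: addr_ge0.
have L0 : 0 <= L by apply: le_trans L1.
rewrite hornerMXaddC hornerD hornerM hornerC (le_trans (ler_normD _ _))//.
rewrite normrM mulrDl lerD//.
  rewrite exprD exprSr !mulrA -[leLHS]mulr1 ler_pM ?mulr_ge0//.
  - by rewrite ler_pM// Ak.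
  - by rewrite exprn_ege1.
by rewrite (le_trans (Ak' _ _ L1 yL))// ler_wpM2l// ler_weXn2l// leq_addl.
Qed.

(** Raise [s / m.+1 <= expR (s / m.+1)] to the power [m.+1]. *)
Lemma exprn_le_expR (R : realType) (s : R) (m : nat) :
  0 <= s -> s ^+ m.+1 <= m.+1%:R ^+ m.+1 * expR s.
Proof.
move=> s0; have m0 : 0 < m.+1%:R :> R by rewrite ltr0n.
rewrite -[in expR s](@mulfVK _ m.+1%:R _ s) ?gt_eqF// expRM_natr -exprMn.
rewrite lerXn2r ?nnegrE ?mulr_ge0 ?expR_ge0 ?(ltW m0)//.
rewrite -ler_pdivrMl// mulrC (le_trans _ (expR_ge1Dx _))// lerDr//.
Qed.

(** With [a = 1 - ln 2 > 0], the quotient of [n 2^n] by [e^n] is [n e^(-a n)], and [a n <= e^(a n)]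
    bounds it by [1/a]. *)
Lemma natrM_exprn2_le_expR (R : realType) :
  exists2 C : R, 0 < C & forall n, n%:R * 2 ^+ n <= C * expR n%:R.
Proof.
have ln2 : 0 < 1 - ln 2 :> R.
  rewrite subr_gt0 -ltr_expR lnK ?posrE// (_ : 2 = 1 + 1)//.
  by rewrite expR_gt1Dx.
exists (1 - ln 2)^-1; first by rewrite invr_gt0.
move=> n; rewrite -[X in X ^+ n](@lnK R) ?posrE// -expRM_natr ler_pdivlMl//.
rewrite mulrA -ler_pdivlMr ?expR_gt0// -expRN -expRD.
rewrite (_ : n%:R + _ = (1 - ln 2) * n%:R); last by ring.
by rewrite (le_trans _ (expR_ge1Dx _))// lerDr.
Qed.

(* Since n and ln S are O(ln T), the hypothesis T <= p.[ln S, n] bounds T by a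
   power of ln T. *)
Lemma polylog_bound (R : realType) (p : {poly {poly R}}) (K B : R) (k : nat) :
  1 <= K -> 0 <= B -> exists M, forall T S y : R, 0 <= T -> 0 <= y ->
    (S = 0 \/ 1 <= S) -> S <= K * (1 + T) ^+ k -> y <= B * (1 + ln (1 + T)) ->
    T <= p.[ln S, y] -> y <= M.
Proof.
move=> K1 B0; have [A [m [A0 Am]]] := norm_horner2_le p.
have K0 : 0 < K by apply: lt_le_trans K1.
have lnK0 := ln_ge0 K1.
(* Large enough that [B' * s], with [s = 1 + ln (1 + T)], bounds both [ln S] and [y] in absolute
   value. *)
pose B' := 1 + ln K + k%:R + B.
have B'1 : 1 <= B' by rewrite /B' -!addrA lerDl !addr_ge0.
have B'0 : 0 <= B' by apply: le_trans B'1.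
pose A' := 1 + A * B' ^+ m.
have A'0 : 0 <= A' by rewrite addr_ge0// mulr_ge0// exprn_ge0.
exists (B * (m.+1%:R ^+ m.+1 * (expR 1 * A'))) => T S y T0 y0 S01 SK yB Tp.
have T1 : 0 < 1 + T by rewrite ltr_pwDl.
pose s := 1 + ln (1 + T).
have lnT0 : 0 <= ln (1 + T) by rewrite ln_ge0// lerDl.
have s1 : 1 <= s by rewrite lerDl.
have s0 : 0 < s by apply: lt_le_trans s1.
have lnS : `|ln S| <= B' * s.
  (* The logarithm takes the default value 0 at 0. *)
  case: S01 => [->|S1]; first by rewrite ln0// normr0 mulr_ge0// ltW.
  rewrite ger0_norm ?ln_ge0//.
  have : ln S <= ln K + k%:R * ln (1 + T).
    rewrite mulr_natl -lnXn// -lnM ?posrE ?exprn_gt0// ler_ln// posrE.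
      exact: lt_le_trans S1.
    by rewrite mulr_gt0// exprn_gt0.
  move=> /le_trans; apply; rewrite /B' /s.
  have := mulr_ge0 lnK0 lnT0; have := mulr_ge0 B0 lnT0.
  have := ler0n R k; nra.
have ys : `|y| <= B' * s.
  rewrite ger0_norm// (le_trans yB)// ler_wpM2r ?(ltW s0)// /B'.
  by rewrite lerDr !addr_ge0.
have B's1 : 1 <= B' * s by rewrite mulr_ege1.
have Tle : T <= A * (B' * s) ^+ m.
  by rewrite (le_trans Tp)// (le_trans (ler_norm _))// Am.
have exps : expR s <= expR 1 * A' * s ^+ m.
  rewrite expRD lnK ?posrE// -mulrA ler_wpM2l ?expR_ge0// mulrDl mul1r.
  by rewrite lerD ?exprn_ege1// -mulrA -exprMn.
rewrite (le_trans yB)// ler_wpM2l//.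
(* The exponential beats degree [m.+1], while [expR s = e (1 + T)] is at most a multiple of
   [s ^+ m]; cancelling [s ^+ m] bounds [s], hence [y]. *)
have sm : s * s ^+ m <= m.+1%:R ^+ m.+1 * (expR 1 * A') * s ^+ m.
  by rewrite -exprS (le_trans (exprn_le_expR _ (ltW s0)))// -mulrA ler_wpM2l//.
by move: sm; rewrite ler_pM2r// exprn_gt0.
Qed.

(** * Limits along the sizes of the family, and worst-case costs *)

(** No tail misses all of the infinitely many sizes; hence a property that holds eventually holds
    somewhere. *)
Lemma n_to_oo_proper (R : realType) (F : forall n, set (instance R n)) :
  infinite_set (sizes F) -> ProperFilter (n_to_oo F).
Proof.
move=> Finf; split; last exact: n_to_oo_filter.
rewrite /n_to_oo /within /= => -[m _ mF]; apply: Finf.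
apply: (@sub_finite_set _ _ `I_m); last exact: finite_II.
by move=> n Fn /=; rewrite ltnNge; apply/negP => /mF; apply.
Qed.

Lemma near_n_to_oo (R : realType) (F : forall n, set (instance R n))
    (Q : nat -> Prop) :
  (forall n, F n !=set0 -> Q n) -> \forall n \near n_to_oo F, Q n.
Proof. by move=> FQ; apply: (@filterE _ \oo) => n; exact: FQ. Qed.

Lemma le_worst_case (R : realType) (cost : forall n, instance R n -> R)
    (F : forall n, set (instance R n)) n (x : instance R n) :
  finite_worst_case cost F -> F n x -> cost n x <= worst_case cost F n.
Proof. by move=> Ffin Fx; apply: ub_le_sup; [exact: Ffin|exists x]. Qed.

Lemma worst_case_le (R : realType) (cost : forall n, instance R n -> R)
    (F : forall n, set (instance R n)) n (b : R) :
  F n !=set0 -> (forall x, F n x -> cost n x <= b) -> worst_case cost F n <= b.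
Proof.
move=> [x Fx] Fb; apply: ge_sup; first by exists (cost n x), x.
by move=> _ [z Fz <-]; exact: Fb.
Qed.

(** Operation counts are natural numbers. This rules out a very negative [ln T_c], so an upper bound
    on [T_c] controls its absolute value. *)
Lemma worst_case_flops_0or1 (R : realType) (A : classical_algorithm R)
    (F : forall n, set (instance R n)) n :
  finite_worst_case (flops_real A) F -> F n !=set0 ->
  worst_case (flops_real A) F n = 0 \/ 1 <= worst_case (flops_real A) F n.
Proof.
move=> Afin Fn.
have [[x [Fx x0]]|none] := pselect (exists x, F n x /\ (0 < flops A x)%N).
  by right; apply: le_trans (le_worst_case Afin Fx); rewrite ler1n.
left; apply/eqP; rewrite eq_le; apply/andP; split.
  apply: worst_case_le => // x Fx; rewrite /flops_real lern0.
  by apply/negPn/negP; rewrite -lt0n => x0; apply: none; exists x.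
by case: Fn => x Fx; apply: le_trans (le_worst_case Afin Fx); rewrite ler0n.
Qed.

Theorem corollary1 (R : realType)
  (* accuracy, and the level at which a change or a bias is negligible *)
  (eps negl : nat -> R)
  (heps : forall n, 0 < eps n < 1)
  (hnegl0 : forall n, 0 <= negl n)
  (hnegl : negl n / eps n @[n --> \oo] --> (0 : R))
  (* the family of instances *)
  (F : forall n, set (instance R n))
  (hinf : infinite_set (sizes F))
  (hvalid : forall n (x : instance R n), F n x -> valid_instance x)
  (hsize : polynomial_size F)
  (hactive : forall n (x : instance R n), F n x -> all_qubits_active (negl n) x)
  (hvol : forall n (x : instance R n), F n x -> (n <= active_volume (negl n) x)%N)
  (* the noisy device and the error mitigation protocol *)
  (N : noise_model R) (P : em_protocol R)
  (lambda : forall n, instance R n -> R)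
  (hbias : forall n (x : instance R n), F n x -> bias_at_most N P (negl n) x)
  (hstat : forall n (x : instance R n), F n x ->
     statistical_error (em_estimate N P x (em_shots P x)) <= eps n)
  (hlambda : forall n (x : instance R n), F n x -> 0 < lambda n x)
  (htime : exists2 c : R, 0 < c & forall n (x : instance R n), F n x ->
     c * (depth x)%:R * (em_shots P x)%:R <= em_time P x)
  (htime_fin : finite_worst_case (@em_time R P) F)
  (* the best available classical algorithm *)
  (avail : classical_algorithm R -> Prop) (best : classical_algorithm R)
  (hbest : best_available avail eps F best)
  (hsv : exists2 A, avail A & solves eps F A /\ state_vector_cost negl F A)
  (gbar : R) (hgbar : 0 < gbar <= 1)
  (hcases :
     (* (i) *)
     (forall n (x : instance R n), F n x ->
        gbar <= lambda n x * avg_infidelity N (circ x) /\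
        (eps n ^+ 2)^-1 *
          expR (lambda n x * avg_infidelity N (circ x) *
                (active_volume (negl n) x)%:R) <= (em_shots P x)%:R)
     \/
     (* (ii) *)
     (forall n (x : instance R n), F n x ->
        [/\ (n <= depth x)%N,
            depth_bound_conditions N P (eps n) x,
            gbar <= lambda n x * avg_infidelity N (circ x) &
            depth_bound_conditions N P (eps n) x ->
            (eps n ^+ 2)^-1 *
              expR (lambda n x * avg_infidelity N (circ x) * (depth x)%:R)
              <= (em_shots P x)%:R])) :
  let T_c := worst_case (flops_real best) F in
  let T_EM := worst_case (@em_time R P) F in
  [/\ T_c =O_ (n_to_oo F) (fun n => T_EM n `^ gbar^-1),
      asymptotic_advantage (n_to_oo F) T_EM T_c ->
        polynomial_advantage (n_to_oo F) T_EM T_c &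
      ~ exponential_advantage (n_to_oo F) T_EM T_c].
Proof.
move=> T_c T_EM.
have [c c0 hc] := htime; have [gbar0 gbar1] := andP hgbar.
have r1 : 1 <= gbar^-1 by rewrite invf_ge1.
have r0 : 0 <= gbar^-1 by apply: le_trans r1.
have D1 n (x : instance R n) : F n x -> 1 <= (depth x)%:R :> R.
  by move=> /hvalid[]; rewrite ler1n.
have em_lower n (x : instance R n) : F n x ->
    c * (depth x)%:R * expR (gbar * n%:R) <= em_time P x.
  move=> Fx; apply: le_trans (hc _ _ Fx).
  rewrite ler_wpM2l ?mulr_ge0 ?(ltW c0)//.
  (* Serves both cases: [a] is [lambda] times the infidelity, [w] the active volume or the depth. *)
  have shots (a w : R) : gbar <= a -> n%:R <= w ->
      (eps n ^+ 2)^-1 * expR (a * w) <= (em_shots P x)%:R ->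
      expR (gbar * n%:R) <= (em_shots P x)%:R.
    move=> ga nw; apply: le_trans; have /andP[e0 e1] := heps n.
    have eps2 : 1 <= (eps n ^+ 2)^-1.
      by rewrite invf_ge1 ?exprn_gt0// exprn_ile1 ?ltW.
    rewrite -[leLHS]mul1r ler_pM ?expR_ge0// ler_expR ler_pM// ltW//.
  case: hcases => [/(_ _ _ Fx)[ga]|/(_ _ _ Fx)[nD cond ga /(_ cond)]].
    by apply: shots => //; rewrite ler_nat hvol.
  by apply: shots => //; rewrite ler_nat.
have em_gt0 n (x : instance R n) : F n x -> 0 < em_time P x.
  move=> Fx; apply: lt_le_trans (em_lower _ _ Fx).
  by rewrite !mulr_gt0 ?expR_gt0// (lt_le_trans _ (D1 _ _ Fx)).
have T_EM_lower n : F n !=set0 -> c * expR (gbar * n%:R) <= T_EM n.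
  move=> [x Fx]; apply: le_trans (le_worst_case htime_fin Fx).
  apply: le_trans (em_lower _ _ Fx); rewrite ler_wpM2r ?expR_ge0//.
  by rewrite ler_peMr ?(ltW c0)// D1.
have T_EM_ge0 n : F n !=set0 -> 0 <= T_EM n.
  by move=> Fn; apply: le_trans (T_EM_lower _ Fn); rewrite mulr_ge0 ?expR_ge0 ?ltW.
have [_ [_ best_fin] best_min] := hbest.
have [A availA [solvA [K sv]]] := hsv.
have [E E0 nE] := natrM_exprn2_le_expR R.
have T_c_cases n : F n !=set0 -> T_c n = 0 \/ 1 <= T_c n.
  exact: worst_case_flops_0or1.
have T_c_ge0 n : F n !=set0 -> 0 <= T_c n.
  by move=> /T_c_cases[->//|]; apply: le_trans.
(* [K] and [E] come from the bounds [K V 2^n] and [n 2^n <= E e^n], the division from the power of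
   [c] in the lower bound on [em_time]. *)
pose C1 := `|K| * E / c `^ gbar^-1.
have C10 : 0 <= C1 by rewrite mulr_ge0 ?invr_ge0 ?powR_ge0// mulr_ge0// ltW.
have T_A_le n : F n !=set0 ->
    worst_case (flops_real A) F n <= C1 * T_EM n `^ gbar^-1.
  move=> Fn; apply: worst_case_le => // x Fx.
  apply: le_trans (sv _ _ Fx) _.
  apply: (@le_trans _ _ (`|K| * E * ((depth x)%:R * expR n%:R))).
    rewrite -!mulrA (le_trans (ler_norm _))// normrM ler_wpM2l//.
    rewrite ger0_norm ?mulr_ge0 ?exprn_ge0// [leRHS]mulrCA.
    rewrite (@le_trans _ _ ((depth x)%:R * (n%:R * 2 ^+ n)))//.
      rewrite mulrA -natrM ler_wpM2r ?exprn_ge0// ler_nat.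
      exact: active_volume_le.
    by rewrite ler_wpM2l.
  rewrite /C1 -!mulrA ler_wpM2l// ler_wpM2l ?(ltW E0)//.
  rewrite ler_pdivlMl ?powR_gt0//.
  have emT := le_worst_case htime_fin Fx.
  apply: (@le_trans _ _ (em_time P x `^ gbar^-1)); last first.
    by rewrite ge0_ler_powR ?nnegrE ?T_EM_ge0// ltW// em_gt0.
  (* The power [gbar^-1] turns [e^(gbar n)] into [e^n], and does not decrease the depth, which is at
     least 1. *)
  apply: (@le_trans _ _ ((c * (depth x)%:R * expR (gbar * n%:R)) `^ gbar^-1)).
    rewrite !powRM ?mulr_ge0 ?expR_ge0 ?(ltW c0)// -mulrA.
    rewrite ler_wpM2l ?powR_ge0// -expRM mulrAC divff ?gt_eqF// mul1r.
    by rewrite ler_wpM2r ?expR_ge0// le1r_powR// D1.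
  rewrite ge0_ler_powR ?nnegrE ?em_lower// ?(ltW (em_gt0 _ _ Fx))//.
  by rewrite !mulr_ge0 ?expR_ge0 ?(ltW c0).
have [k k0 T_cA] : exists2 k : R, 0 < k &
    \forall n \near n_to_oo F, `|T_c n| <= k * `|worst_case (flops_real A) F n|.
  by apply/eqO_exP; apply: best_min.
(* The summand 1 provides the [1 <= K] of [polylog_bound]. *)
pose C := 1 + k * C1.
have C1ge : 1 <= C by rewrite lerDl mulr_ge0// ltW.
have C0 : 0 < C by apply: lt_le_trans C1ge.
have inF : \forall n \near n_to_oo F, F n !=set0 by apply: near_n_to_oo.
have T_c_le : \forall n \near n_to_oo F, T_c n <= C * T_EM n `^ gbar^-1.
  near=> n; have Fn : F n !=set0 by near: n.
  apply: (@le_trans _ _ (k * C1 * T_EM n `^ gbar^-1)); last first.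
    by rewrite ler_wpM2r ?powR_ge0// lerDr.
  rewrite (le_trans (ler_norm _))// (@le_trans _ _
    (k * `|worst_case (flops_real A) F n|))//; first by near: n.
  rewrite -mulrA ler_wpM2l ?(ltW k0)// ger0_norm ?T_A_le//.
  have [_ Afin] := solvA.
  by case: (worst_case_flops_0or1 Afin Fn) => [->//|]; apply: le_trans.
(* A natural exponent makes the bound polynomial; the base [1 + T_EM n] is at least 1, so the
   exponent may grow. *)
have [q rq] : exists q : nat, gbar^-1 <= q%:R.
  by exists (Num.truncn gbar^-1).+1; rewrite ltW// truncnS_gt.
have T_c_poly : \forall n \near n_to_oo F, T_c n <= C * (1 + T_EM n) ^+ q.
  near=> n; have /T_EM_ge0 T0 : F n !=set0 by near: n.
  apply: (@le_trans _ _ (C * T_EM n `^ gbar^-1)); first by near: n.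
  rewrite ler_wpM2l ?(ltW C0)// -powR_mulrn ?addr_ge0//.
  apply: (@le_trans _ _ ((1 + T_EM n) `^ gbar^-1)).
    by rewrite ge0_ler_powR ?nnegrE ?addr_ge0// lerDr.
  by rewrite ler_powR// lerDl.
split.
- apply/eqO_exP; exists C => //; near=> n.
  have Fn : F n !=set0 by near: n.
  by rewrite !ger0_norm ?powR_ge0 ?T_c_ge0//; near: n.
- move=> adv; split=> //; exists (C%:P%:P * (1 + 'X) ^+ q).
  near=> n; rewrite !hornerE; near: n.
  exact: T_c_poly.
- move=> [_ [p Tp]].
  have FF := n_to_oo_proper hinf.
  (* From [c e^(gbar n) <= T_EM n]: [gbar n] is at most [ln (1 + T_EM n) - ln c]. *)
  pose B := gbar^-1 * (1 + `|ln c|).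
  have B0 : 0 <= B by rewrite mulr_ge0// addr_ge0.
  have [M HM] := polylog_bound p q C1ge B0.
  suff : \forall n \near n_to_oo F, False by move/filter_ex => [].
  near=> n.
  have Fn : F n !=set0 by near: n.
  have nM : M < n%:R.
    near: n; apply: cvg_within.
    exact: nbhs_infty_gtr.
  suff : n%:R <= M by rewrite leNgt nM.
  apply: (HM (T_EM n) (T_c n)) => //; [exact: T_EM_ge0|exact: T_c_cases| | |].
  + by near: n.
  + have T1 : 0 < 1 + T_EM n by rewrite ltr_pwDl// T_EM_ge0.
    rewrite /B -mulrA ler_pdivlMl//.
    have lnT : ln c + gbar * n%:R <= ln (1 + T_EM n).
      rewrite -[X in _ + X]expRK -lnM ?posrE ?expR_gt0// ler_ln ?posrE//.
        by rewrite (le_trans (T_EM_lower _ Fn))// lerDr.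
      by rewrite mulr_gt0 ?expR_gt0.
    have lnT0 : 0 <= ln (1 + T_EM n) by rewrite ln_ge0// lerDl T_EM_ge0.
    have := ler_norm (- ln c); rewrite normrN => lnc.
    have := mulr_ge0 (normr_ge0 (ln c)) lnT0; nra.
  + by near: n.
Unshelve. all: by end_near.
Qed.
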